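(* Let $k$, $\ell$, and $n$ be non-negative integers with $k\neq 0$. Then the $k$-Pell-Lucas number $Q_{k,\ell n}$ can be represented by the integral $$Q_{k,\ell n}=\frac{1}{2^n}\int_{-1}^{1}\left(Q_{k,\ell}+2(n+1)\sqrt{1+k}\, P_{k,\ell}\, x\right)\left(Q_{k,\ell}+2\sqrt{1+k}\, P_{k,\ell}\, x\right)^{n-1}dx.$$
   Context: For a positive integer $k$, the $k$-Pell numbers $P_{k,n}$ ($n\ge 0$) are defined by $P_{k,0}=0$, $P_{k,1}=1$ and $P_{k,n}=2P_{k,n-1}+kP_{k,n-2}$ for $n\ge 2$. The $k$-Pell-Lucas numbers $Q_{k,n}$ ($n\ge 0$) are defined by $Q_{k,0}=2$, $Q_{k,1}=2$ and $Q_{k,n}=2Q_{k,n-1}+kQ_{k,n-2}$ for $n\ge 2$. *)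

(* Defs.v *)
From Stdlib Require Import Arith.

Fixpoint kPell (k n : nat) {struct n} : nat :=
  match n with
  | 0 => 0
  | S m => match m with
           | 0 => 1
           | S p => 2 * kPell k m + k * kPell k p
           end
  end.

Fixpoint kPellLucas (k n : nat) {struct n} : nat :=
  match n with
  | 0 => 2
  | S m => match m with
           | 0 => 2
           | S p => 2 * kPellLucas k m + k * kPellLucas k p
           end
  end.

(* Main.v *)
Require Import Defs.
From Stdlib Require Import Reals ZArith Lra Lia.
From Coquelicot Require Import Coquelicot.
Open Scope R_scope.

(** Write [s = sqrt (1 + k)], [A = Q_{k,l}] and [B = 2 s P_{k,l}].  The integrand
    [(A + (n + 1) B x) (A + B x)^(n-1)] is the derivative of [x (A + B x)^n] by
    the product rule, so the integral equals [(A + B)^n + (A - B)^n].  The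
    numbers [1 + s] and [1 - s] are the roots of [X^2 = 2 X + k], and the Binet
    formulas [kPellLucas_binet] and [kPell_binet] give [A + B = 2 (1 + s)^l] and
    [A - B = 2 (1 - s)^l].  Hence the integral is
    [2^n ((1 + s)^(l n) + (1 - s)^(l n))], which is [2^n Q_{k,ln}] by the Binet
    formula again.

    For [n = 0] the antiderivative is still [x], but the integrand is
    [(A + B x) / (A + B x)], which may differ from [1] at the zero of [A + B x];
    cutting the interval at that point removes the difference. *)

(** The recursion has depth two, hence the induction on two consecutive terms. *)
Lemma kPellLucas_binet (k : nat) (s : R) (hs : s * s = 1 + INR k) (n : nat) :
  INR (kPellLucas k n) = (1 + s) ^ n + (1 - s) ^ n.
Proof.
  enough (H : INR (kPellLucas k n) = (1 + s) ^ n + (1 - s) ^ n /\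
              INR (kPellLucas k (S n)) = (1 + s) ^ S n + (1 - s) ^ S n)
    by apply H.
  induction n as [|n [IH0 IH1]].
  - simpl; split; ring.
  - split; [exact IH1|].
    change (kPellLucas k (S (S n)))
      with (2 * kPellLucas k (S n) + k * kPellLucas k n)%nat.
    rewrite plus_INR, !mult_INR, IH0, IH1.
    replace (INR k) with (s * s - 1) by lra.
    simpl; ring.
Qed.

(** Multiplying by [2 s] avoids the division in the usual form of the formula,
    and [2 s P] is the coefficient that occurs in the integrand. *)
Lemma kPell_binet (k : nat) (s : R) (hs : s * s = 1 + INR k) (n : nat) :
  2 * s * INR (kPell k n) = (1 + s) ^ n - (1 - s) ^ n.
Proof.
  enough (H : 2 * s * INR (kPell k n) = (1 + s) ^ n - (1 - s) ^ n /\
              2 * s * INR (kPell k (S n)) = (1 + s) ^ S n - (1 - s) ^ S n)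
    by apply H.
  induction n as [|n [IH0 IH1]].
  - simpl; split; ring.
  - split; [exact IH1|].
    change (kPell k (S (S n))) with (2 * kPell k (S n) + k * kPell k n)%nat.
    rewrite plus_INR, !mult_INR.
    replace (2 * s * (INR 2 * INR (kPell k (S n)) + INR k * INR (kPell k n)))
      with (2 * (2 * s * INR (kPell k (S n)))
            + INR k * (2 * s * INR (kPell k n))) by (simpl; ring).
    rewrite IH0, IH1.
    replace (INR k) with (s * s - 1) by lra.
    simpl; ring.
Qed.

(** Both integrals from [a] to [c] and from [c] to [b] only see values off [c],
    and they add up wherever [c] lies, inside the interval or not. *)
Lemma is_RInt_const_except (f : R -> R) (a b c v : R)
  (hf : forall x, x <> c -> f x = v) : is_RInt f a b ((b - a) * v).
Proof.
  assert (H : forall p q, p = c \/ q = c -> is_RInt f p q ((q - p) * v)).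
  { intros p q hpq.
    apply is_RInt_ext with (fun _ : R => v).
    - intros x Hx; symmetry; apply hf; intros ->.
      revert Hx; unfold Rmin, Rmax.
      destruct (Rle_dec p q), hpq; lra.
    - apply @is_RInt_const. }
  replace ((b - a) * v) with (plus ((c - a) * v) ((b - c) * v))
    by (unfold plus; simpl; ring).
  apply (is_RInt_Chasles f a c b); apply H; auto.
Qed.

(** The antiderivative is [x (A + B x)^n].  For [n = 0] the hypothesis keeps
    the base from vanishing identically, so that it has at most one zero. *)
Lemma is_RInt_affine_powerRZ (A B : R) (n : nat) (hAB : A + B <> 0) :
  is_RInt (fun x => (A + (INR n + 1) * B * x)
                    * powerRZ (A + B * x) (Z.of_nat n - 1))
    (-1) 1 ((A + B) ^ n + (A - B) ^ n).
Proof.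
  destruct n as [|m].
  - replace ((A + B) ^ 0 + (A - B) ^ 0) with ((1 - -1) * 1) by (simpl; ring).
    (* If [B = 0] the base is the nonzero constant [A], and any point serves. *)
    apply is_RInt_const_except with (- A / B).
    intros x hx; simpl.
    assert (A + B * x <> 0).
    { intros H0; destruct (Req_dec B 0) as [->|HB]; [apply hAB; lra|].
      apply hx; apply Rmult_eq_reg_l with B; [|exact HB].
      replace (B * (- A / B)) with (- A) by (field; exact HB); lra. }
    field; lra.
  - replace (Z.of_nat (S m) - 1)%Z with (Z.of_nat m) by lia.
    apply is_RInt_ext with
      (fun x => (A + (INR (S m) + 1) * B * x) * (A + B * x) ^ m).
    { intros x _; now rewrite pow_powerRZ. }
    replace ((A + B) ^ S m + (A - B) ^ S m)
      with (minus (1 * (A + B * 1) ^ S m) (-1 * (A + B * -1) ^ S m)).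
    2:{ replace (A + B * 1) with (A + B) by ring.
        replace (A + B * -1) with (A - B) by ring.
        unfold minus, plus, opp; simpl; ring. }
    apply (is_RInt_derive (fun x => x * (A + B * x) ^ S m)).
    + intros x _; auto_derive; [exact I|].
      (* The derivative of the power carries [INR (S m)] in unfolded form. *)
      change (match m with 0%nat => 1 | S _ => INR m + 1 end) with (INR (S m)).
      rewrite S_INR; ring.
    + intros x _.
      apply (ex_derive_continuous
               (fun x => (A + (INR (S m) + 1) * B * x) * (A + B * x) ^ m)).
      auto_derive; exact I.
Qed.

(* The exponent [n - 1] is an integer, equal to [-1] when [n = 0]. In that case
   the integrand is [1] except at the at most one zero of the base, where the
   formula is [0 * / 0] and its value does not affect the integral. *)
Theorem theorem3p5 (k l n : nat) (hk : k <> 0%nat) :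
  let f := fun x : R =>
    (INR (kPellLucas k l)
       + 2 * (INR n + 1) * sqrt (1 + INR k) * INR (kPell k l) * x)
    * powerRZ (INR (kPellLucas k l)
                 + 2 * sqrt (1 + INR k) * INR (kPell k l) * x)
              (Z.of_nat n - 1) in
  ex_RInt f (-1) 1 /\
  INR (kPellLucas k (l * n)) = 1 / 2 ^ n * RInt f (-1) 1.
Proof.
  intros f.
  set (s := sqrt (1 + INR k)) in *.
  assert (hk0 := pos_INR k).
  assert (hs : s * s = 1 + INR k) by (apply sqrt_sqrt; lra).
  assert (hs0 : 0 <= s) by apply sqrt_pos.
  set (A := INR (kPellLucas k l)) in *.
  set (B := 2 * s * INR (kPell k l)) in *.
  assert (hp : A + B = 2 * (1 + s) ^ l)
    by (unfold A, B; rewrite (kPellLucas_binet k s hs), (kPell_binet k s hs); ring).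
  assert (hm : A - B = 2 * (1 - s) ^ l)
    by (unfold A, B; rewrite (kPellLucas_binet k s hs), (kPell_binet k s hs); ring).
  assert (hAB : A + B <> 0).
  { assert (0 < (1 + s) ^ l) by (apply pow_lt; lra). lra. }
  assert (Hf : is_RInt f (-1) 1 ((A + B) ^ n + (A - B) ^ n)).
  { eapply is_RInt_ext; [|exact (is_RInt_affine_powerRZ A B n hAB)].
    intros x _; unfold f; f_equal; unfold B; ring. }
  split; [eexists; exact Hf|].
  rewrite (is_RInt_unique _ _ _ _ Hf), hp, hm, (kPellLucas_binet k s hs).
  rewrite !Rpow_mult_distr, <- !pow_mult.
  field; apply pow_nonzero; lra.
Qed.
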